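(* Let $X$ be a normed space of dimension $d\geq 2$ and let $L$ be a positive integer. Then $$\Gamma(X)\ \geq\ (L+2)^{-1}\left((2L)^{\frac{1}{L+1}}\,(1+L^{-1})\right)^{-d}\gamma(X).$$ In particular (choosing $L=d\log d+O(1)$), one gets $$\Gamma(X)\ \geq\ e^{-1-\frac{\log\log d}{\log d}+O\left(\frac{1}{\log d}\right)}\,\frac{\gamma(X)}{d\log d},$$ that is, there is an absolute constant $K>0$ (independent of $d$ and $X$) such that for every $d\geq 2$ and every normed space $X$ of dimension $d$, $$\Gamma(X)\ \geq\ \exp\Bigl(-1-\frac{\log\log d}{\log d}-\frac{K}{\log d}\Bigr)\,\frac{\gamma(X)}{d\log d}.$$
   Context: Normed spaces are real and finite-dimensional. A ball in $X$ always means a closed ball of positive radius. $|E|$ denotes the Lebesgue measure of $E\subseteq X$ (with any fixed normalization; only ratios matter), and $\log$ is the natural logarithm. A collection of balls is disjoint if its members are pairwise disjoint. For a nonempty finite collection $\mathcal{C}$ of balls in $X$, define $$\Phi(\mathcal{C}):=\max\left\{\frac{|\bigcup_{B\in\mathcal{S}}B|}{|\bigcup_{B\in\mathcal{C}}B|}:\ \mathcal{S}\subseteq\mathcal{C}\ \text{is disjoint}\right\}.$$ For a set $S\subset(0,\infty)$ let $\mathcal{A}(X;S)$ be the set of all (nonempty) finite collections of balls in $X$ with radii in $S$, and define $\Gamma(X;S):=\inf\{\Phi(\mathcal{C}):\mathcal{C}\in\mathcal{A}(X;S)\}$. Finally, $\Gamma(X):=\Gamma(X;(0,\infty))$ and $\gamma(X):=\Gamma(X;\{1\})$.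 *)

(* Defs.v *)
From HB Require Import structures.
From mathcomp Require Import all_boot all_order all_algebra.
From mathcomp Require Import all_classical all_reals all_analysis.

Set Implicit Arguments.
Unset Strict Implicit.
Unset Printing Implicit Defensive.

Import Order.TTheory GRing.Theory Num.Theory.
Import numFieldNormedType.Exports.

Local Open Scope classical_set_scope.
Local Open Scope ring_scope.

(* The dimension of X is \dim {:X}. *)
#[short(type="finNormedModType")]
HB.structure Definition FinNormedModule (R : numFieldType) :=
  {X of NormedModule R X & Vector R X}.

Section Lebesgue.
Context {R : realType} {X : finNormedModType R}.

Let n := \dim {:X}.

Definition box (a b : 'I_n -> R) : set X :=
  [set x | forall i, a i <= coord (vbasis {:X}) i x <= b i].

Definition box_volume (a b : 'I_n -> R) : R := \prod_(i < n) (b i - a i).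

(* Lebesgue (outer) measure on X, as the infimum of the total volumes of the
   countable coverings by boxes; it is normalized by giving measure 1 to the
   unit parallelepiped of the basis vbasis {:X}. *)
Definition vlebesgue (E : set X) : \bar R :=
  ereal_inf [set s | exists a b : nat -> 'I_n -> R,
    [/\ forall k i, a k i <= b k i,
        E `<=` \bigcup_k box (a k) (b k) &
        s = (\sum_(0 <= k <oo) (box_volume (a k) (b k))%:E)%E]].

(* Only used for bounded sets, whose measure is finite. *)
Definition vol (E : set X) : R := fine (vlebesgue E).

End Lebesgue.

Section Vitali.
Context {R : realType} {X : finNormedModType R}.

Definition ball_collection (S : set R) (C : set (set X)) : Prop :=
  [/\ finite_set C, C !=set0 &
      forall B, C B ->
        exists (x : X) (r : R), [/\ 0 < r, S r & B = closed_ball x r]].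

(* For a finite C the supremum is a maximum: C has finitely many
   subcollections, among which the empty one is disjoint. *)
Definition Phi (C : set (set X)) : R :=
  sup [set vol (\bigcup_(B in D) B) / vol (\bigcup_(B in C) B) |
       D in [set D : set (set X) | D `<=` C /\ trivIset D id]].

End Vitali.

Definition Gamma_in (R : realType) (X : finNormedModType R) (S : set R) : R :=
  inf [set Phi C | C in [set C : set (set X) | ball_collection S C]].

Definition Gamma (R : realType) (X : finNormedModType R) : R :=
  Gamma_in X [set r | 0 < r].

Definition gamma (R : realType) (X : finNormedModType R) : R :=
  Gamma_in X [set 1].

(* Main.v *)
From HB Require Import structures.
Require Import Defs.
From mathcomp Require Import all_boot all_order all_algebra.
From mathcomp Require Import all_classical all_reals all_analysis.
From mathcomp Require Import ring lra.

(** Sort the balls of a finite collection by scale, the scale of a radius [r]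
    being the integer part of its logarithm in base [rho = (2 L) ^ (1 / (L + 1))].
    One of the [L + 2] residue classes of scales modulo [L + 2] carries at least
    the fraction [1 / (L + 2)] of the volume ([largest_fiber_vol]).  Inside that
    class, balls of the same scale have radii within a factor [rho], and balls of
    different scales have radii at least [rho ^ (L + 1) = 2 L] apart
    ([same_scale], [distinct_scales]).

    Now run through the scales from the largest down
    ([separated_scales_selection]).  At each scale replace the remaining balls by
    the concentric balls of radius [t], where [t] is [1 + 1 / L] times the largest
    radius of that scale.  After rescaling, the definition of [gamma X] yields
    disjoint balls among these whose union has nearly the proportion [gamma X] of
    the volume of all of them ([equal_radius_selection]); keep the corresponding
    original balls, and drop all smaller balls that meet a kept one.  A dropped
    ball has radius at most [r / (2 L)] when it meets a kept ball of radius [r], so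
    it lies inside the [(1 + 1 / L)]-enlargement of the latter and was already
    counted in the volume of the balls of radius [t].  Going back from radius [t]
    to the original radii costs the factor [(rho (1 + 1 / L)) ^ d] in volume, which
    is the remaining factor of the bound.

    The argument uses only that volume is monotone, finitely subadditive,
    additive on disjoint closed balls, and multiplied by [c ^ d] under homotheties
    of ratio [c].  For additivity, coverings by boxes can be cut along a
    coordinate hyperplane, so coordinate half-spaces satisfy Caratheodory's
    criterion, and then so do closed balls ([closed_ball_caratheodory]).

    The asymptotic bound is the choice [L = floor (d ln d)]
    ([optimal_parameter]). *)

Set Implicit Arguments.
Unset Strict Implicit.
Unset Printing Implicit Defensive.

Import Order.TTheory GRing.Theory Num.Theory.
Import numFieldNormedType.Exports.

Local Open Scope classical_set_scope.
Local Open Scope ring_scope.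

(** * The covering outer measure *)

Section OuterMeasure.
Context {R : realType} {X : finNormedModType R}.
Implicit Types (E A B : set X) (x y : X).

Local Notation n := (\dim {:X}).

Lemma box_volume_ge0 (a b : 'I_n -> R) :
  (forall i, a i <= b i) -> 0 <= box_volume a b.
Proof. by move=> ab; apply: prodr_ge0 => i _; rewrite subr_ge0. Qed.

Lemma vlebesgue_ge0 E : (0 <= vlebesgue E)%E.
Proof.
apply: le_ereal_inf_tmp => _ [a [b [ab _ ->]]].
by apply: nneseries_ge0 => k _ _; rewrite lee_fin box_volume_ge0.
Qed.

Lemma vlebesgue_cover E (a b : nat -> 'I_n -> R) :
  (forall k i, a k i <= b k i) -> E `<=` \bigcup_k box (a k) (b k) ->
  (vlebesgue E <= \sum_(0 <= k <oo) (box_volume (a k) (b k))%:E)%E.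
Proof. by move=> ab EU; apply: ereal_inf_lbound; exists a, b. Qed.

Lemma le_vlebesgue : {homo @vlebesgue R X : A B / A `<=` B >-> (A <= B)%E}.
Proof.
move=> A B AB; apply: le_ereal_inf_tmp => _ [a [b [ab Bab ->]]].
by apply: vlebesgue_cover => //; exact: subset_trans AB Bab.
Qed.

(** A covering by degenerate boxes; in dimension zero a box has volume [1], the
    value of the empty product, and the empty set has infinite measure. *)
Lemma vlebesgue0 : (0 < n)%N -> vlebesgue (set0 : set X) = 0%E.
Proof.
move=> n0; apply/eqP; rewrite eq_le vlebesgue_ge0 andbT.
apply: le_trans (vlebesgue_cover (a := fun _ _ => 0) (b := fun _ _ => 0) _ _) _.
- by [].
- by [].
- rewrite eseries0// => k _ _; congr (_%:E).
  by rewrite /box_volume (bigD1 (Ordinal n0))//= subr0 mul0r.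
Qed.

(** Nearly optimal coverings of the [A k], with errors [e / 2 ^ k.+1], are merged
    into one covering through a bijection between [nat] and [nat * nat]. *)
Lemma vlebesgue_sigma_subadditive : sigma_subadditive (@vlebesgue R X).
Proof.
move=> A; have [[i ioo]|] := pselect (exists i, vlebesgue (A i) = +oo%E).
  rewrite (eseries_pinfty _ _ ioo) ?leey// => k _.
  by rewrite -ltNye (lt_le_trans _ (vlebesgue_ge0 _)).
rewrite -forallNE => Aoo.
apply/lee_addgt0Pr => e e0.
apply: le_trans (epsilon_trick _ _ (ltW e0)); last by move=> k; exact: vlebesgue_ge0.
have en k : 0 < e / (2 ^ k.+1)%:R by rewrite divr_gt0// ltr0n expn_gt0.
have /choice[G PG] k : exists ab : (nat -> 'I_n -> R) * (nat -> 'I_n -> R),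
    [/\ forall j i, ab.1 j i <= ab.2 j i,
        A k `<=` \bigcup_j box (ab.1 j) (ab.2 j) &
        (\sum_(0 <= j <oo) (box_volume (ab.1 j) (ab.2 j))%:E <=
         vlebesgue (A k) + (e / (2 ^ k.+1)%:R)%:E)%E].
  have Afin : vlebesgue (A k) \is a fin_num.
    by rewrite ge0_fin_numE ?vlebesgue_ge0// ltey; apply/eqP/Aoo.
  have [_ [a [b [ab Aab ->]]] lt] := lb_ereal_inf_adherent (en k) Afin.
  by exists (a, b); split => //; exact: ltW.
pose f (p : nat * nat) := (box_volume ((G p.1).1 p.2) ((G p.1).2 p.2))%:E.
have f0 p : (0 <= f p)%E.
  by rewrite lee_fin; apply: box_volume_ge0; case: (PG p.1).
have /card_esym/ppcard_eqP[g] := card_nat2.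
apply: (@le_trans _ _ (\esum_(p in [set: nat * nat]) f p)).
  rewrite (reindex_esum [set: nat] _ g)//.
  rewrite -nneseries_esumT//; apply: vlebesgue_cover => [k i|x [k _ Akx]].
    by case: (PG (g k).1).
  have [_ /(_ _ Akx)[j _ xj] _] := PG k.
  by exists (g^-1%FUN (k, j)) => //; rewrite invK ?inE.
have -> : [set: nat * nat] = [set: nat] `*`` (fun=> [set: nat]).
  by apply/seteqP; split.
rewrite -(@esum_esum _ _ _ _ _ (fun i j => f (i, j)))//=.
rewrite -nneseries_esumT; last by move=> k; exact: esum_ge0.
apply: lee_nneseries => [k _ _|k _]; first exact: esum_ge0.
by rewrite -nneseries_esumT//; case: (PG k).
Qed.

End OuterMeasure.

(** * Homotheties *)

Section Scaling.
Context {R : realType} {X : finNormedModType R}.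
Local Notation n := (\dim {:X}).
Local Notation crd := (coord (vbasis {:X})).

Lemma vlebesgue_homothety_le (c : R) (t : X) (E : set X) : 0 < c ->
  (vlebesgue [set (c *: x + t)%R | x in E] <= (c ^+ n)%:E * vlebesgue E)%E.
Proof.
move=> c0; rewrite muleC -lee_pdivrMr ?exprn_gt0//.
apply: le_ereal_inf_tmp => _ [a [b [ab Eab ->]]].
rewrite lee_pdivrMr ?exprn_gt0// muleC -nneseriesZl; last first.
  by move=> k _; rewrite lee_fin box_volume_ge0.
pose f (v : 'I_n -> R) i := c * v i + crd i t.
apply: le_trans (vlebesgue_cover (a := f \o a) (b := f \o b) _ _) _.
- by move=> k i; rewrite /f/= lerD2r ler_pM2l.
- move=> _ [x /Eab[k _ xk] <-]; exists k => //= i; rewrite /f.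
  by rewrite linearD linearZ/= !lerD2r !ler_pM2l// xk.
- apply: lee_nneseries => k _ *.
    by rewrite lee_fin box_volume_ge0// => i; rewrite /f/= lerD2r ler_pM2l.
  rewrite -EFinM lee_fin /box_volume /f/=.
  have -> : c ^+ n = \prod_(i < n) c by rewrite prodr_const card_ord.
  rewrite -big_split/=.
  apply: ler_prod => i _; rewrite opprD addrACA subrr addr0 -mulrBr lexx andbT.
  by rewrite mulr_ge0 ?(ltW c0)// subr_ge0.
Qed.

Lemma vlebesgue_homothety (c : R) (t : X) (E : set X) : 0 < c ->
  vlebesgue [set (c *: x + t)%R | x in E] = ((c ^+ n)%:E * vlebesgue E)%E.
Proof.
move=> c0; apply/eqP; rewrite eq_le vlebesgue_homothety_le//=.
have ci0 : 0 < c^-1 by rewrite invr_gt0.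
have := vlebesgue_homothety_le (- (c^-1 *: t)) [set (c *: x + t)%R | x in E] ci0.
set F := image _ _; have -> : F = E.
  have cK x : c^-1 *: (c *: x + t) - c^-1 *: t = x.
    by rewrite scalerDr scalerA mulVf ?gt_eqF// scale1r addrK.
  apply/seteqP; split=> [_ [_ [x Ex <-] <-]|x Ex]; first by rewrite cK.
  by exists (c *: x + t); [exists x | exact: cK].
by rewrite exprVn muleC lee_pdivlMr ?exprn_gt0// muleC.
Qed.
End Scaling.

(** * Caratheodory measurability of closed balls *)

Section Caratheodory.
Context {R : realType} {X : finNormedModType R}.
Local Notation n := (\dim {:X}).
Local Notation crd := (coord (vbasis {:X})).

(** The positivity of the dimension, which makes the empty set null, is carried
    by the name so that the outer measure structure can be inferred from it. *)
Definition outer_vlebesgue (n_gt0 : (0 < n)%N) : set X -> \bar R := vlebesgue.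

HB.instance Definition _ (n_gt0 : (0 < n)%N) :=
  isOuterMeasure.Build R X (outer_vlebesgue n_gt0) (vlebesgue0 n_gt0)
    vlebesgue_ge0 le_vlebesgue vlebesgue_sigma_subadditive.

Variable n_gt0 : (0 < n)%N.
Local Notation mu := (outer_vlebesgue n_gt0).

(** Each box of a covering is cut by the hyperplane into two boxes, possibly
    degenerate, with the same total volume. *)
Lemma halfspace_caratheodory (i : 'I_n) (c : R) :
  mu.-cara.-measurable [set x | crd i x <= c].
Proof.
apply: le_caratheodory_measurable => E.
apply: le_ereal_inf_tmp => _ [a [b [ab Eab ->]]].
(* The cutting value [c], clamped to the [i]-th side of the [k]-th box. *)
pose m k := Num.max (a k i) (Num.min (b k i) c).
have am k : a k i <= m k by rewrite le_max lexx.
have mb k : m k <= b k i by rewrite ge_max ab ge_min lexx.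
pose upd (v : 'I_n -> R) r j := if j == i then r else v j.
apply: (@le_trans _ _ (\sum_(0 <= k <oo) ((box_volume (a k) (upd (b k) (m k)))%:E
    + (box_volume (upd (a k) (m k)) (b k))%:E))%E).
  have le1 k j : a k j <= upd (b k) (m k) j by rewrite /upd; case: eqP => [->|].
  have le2 k j : upd (a k) (m k) j <= b k j by rewrite /upd; case: eqP => [->|].
  rewrite nneseriesD; [|by move=> k _ _; rewrite lee_fin box_volume_ge0..].
  apply: leeD; apply: vlebesgue_cover => // x [Ex /= xc].
  - have [k _ xk] := Eab _ Ex; exists k => // j; rewrite /upd.
    have /andP[xa xb] := xk i.
    by case: eqP => [->|_]; rewrite ?xk// xa le_max le_min xc xb orbT.
  - have [k _ xk] := Eab _ Ex; exists k => // j; rewrite /upd.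
    have /andP[xa xb] := xk i.
    case: eqP => [->|_]; rewrite ?xk// xb ge_max xa/=.
    by rewrite ge_min andbT; apply/orP; right; rewrite ltW// ltNge; apply/negP.
apply: lee_nneseries => [k _ _|k _].
  rewrite -EFinD lee_fin addr_ge0// box_volume_ge0// => j.
    by rewrite /upd; case: eqP => [->|].
  by rewrite /upd; case: eqP => [->|].
rewrite -EFinD lee_fin /box_volume !(bigD1 (P := predT) i)//= /upd eqxx.
rewrite (eq_bigr (fun j => b k j - a k j)); last by move=> j /negbTE ->.
rewrite [X in _ + _ * X](eq_bigr (fun j => b k j - a k j)); last by move=> j /negbTE ->.
by rewrite -mulrDl addrC addrA subrK.
Qed.

(** Half-open rational cells are used since they are Boolean combinations of
    the half-spaces above and there are only countably many of them. *)
Definition cell (q : {ffun 'I_n -> rat} * {ffun 'I_n -> rat}) : set X :=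
  \bigcap_(i in [set: 'I_n])
    ([set x | crd i x <= ratr (q.2 i)] `\` [set x | crd i x <= ratr (q.1 i)]).

Lemma cell_caratheodory q : mu.-cara.-measurable (cell q).
Proof.
apply: fin_bigcap_measurable => // i _.
by apply: measurableD; exact: halfspace_caratheodory.
Qed.

Lemma ler_norm_coord (x : X) (e : R) : (forall i, `|crd i x| <= e) ->
  `|x| <= e * \sum_(i < n) `|(vbasis {:X})`_i|.
Proof.
move=> xe; rewrite {1}(coord_vbasis (memvf x)) mulr_sumr.
apply: le_trans (ler_norm_sum _ _ _) _; apply: ler_sum => i _.
by rewrite normrZ ler_wpM2r.
Qed.

(** The norm is Lipschitz in the coordinates, so every point outside a closed
    ball lies in a rational cell that avoids the ball: the complement of the ball
    is a countable union of cells. *)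
Lemma closed_ball_caratheodory (x : X) (r : R) : 0 < r ->
  mu.-cara.-measurable (closed_ball x r).
Proof.
move=> r0; rewrite closed_ballE// -[X in measurable X]setCK.
apply: measurableC.
set U := ~` _.
pose F q := if pselect (cell q `<=` U) then cell q else set0.
suff -> : U = \bigcup_q F q.
  apply: countable_bigcupT_measurable => [|q]; first exact: countableP.
  by rewrite /F; case: pselect => ?; [exact: cell_caratheodory|exact: measurable0].
apply/seteqP; split=> [y Uy|y [q _]]; last by rewrite /F; case: pselect => // qU; exact: qU.
pose M := 1 + \sum_(i < n) `|(vbasis {:X})`_i|.
have M0 : 0 < M by rewrite ltr_pwDl// sumr_ge0.
have ry : r < `|x - y| by rewrite ltNge; apply/negP.
pose e := (`|x - y| - r) / M.
have e0 : 0 < e by rewrite divr_gt0// subr_gt0.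
have e20 : 0 < e / 2 by rewrite divr_gt0.
have /choice[l lP] i : exists q : rat, crd i y - e / 2 < ratr q < crd i y.
  have /rat_in_itvoo[q] : crd i y - e / 2 < crd i y by rewrite ltrBlDr ltrDl.
  by rewrite in_itv/=; exists q.
have /choice[u uP] i : exists q : rat, crd i y < ratr q < crd i y + e / 2.
  have /rat_in_itvoo[q] : crd i y < crd i y + e / 2 by rewrite ltrDl.
  by rewrite in_itv/=; exists q.
pose q := (finfun l, finfun u).
have yq : cell q y.
  move=> i _ /=; rewrite !ffunE; split; first by have /andP[/ltW] := uP i.
  by apply/negP; rewrite -ltNge; case/andP: (lP i).
exists q => //; rewrite /F; case: pselect => // -[] z zq.
apply/negP; rewrite -ltNge.
have : `|z - y| <= e * \sum_(i < n) `|(vbasis {:X})`_i|.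
  apply: ler_norm_coord => i; have := zq i I; rewrite /= !ffunE => -[zu /negP].
  rewrite -ltNge linearB/= => zl; have /andP[l1 l2] := lP i; have /andP[u1 u2] := uP i.
  by rewrite ler_norml; apply/andP; split; lra.
have : e * \sum_(i < n) `|(vbasis {:X})`_i| < `|x - y| - r.
  rewrite -[X in _ < X](divfK (lt0r_neq0 M0)) -/e ltr_pM2l//.
  by rewrite /M ltrDr.
have := ler_distD z x y; lra.
Qed.

End Caratheodory.

(** * Volumes of finite unions of balls *)

Section BallUnions.
Context {R : realType} {X : finNormedModType R}.
Local Notation n := (\dim {:X}).
Local Notation unit_ball := (closed_ball (0%R : X) 1%R).
Implicit Types (p q : X * R) (s : seq (X * R)).

Definition ball_union s : set X :=
  \big[setU/set0]_(p <- s) closed_ball p.1 p.2.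

Definition positive_radii s := all (fun p => 0 < p.2) s.

Definition apart p q := p.2 + q.2 < `|p.1 - q.1|.

Lemma ball_unionP s x :
  ball_union s x <-> exists2 p, p \in s & closed_ball p.1 p.2 x.
Proof. by rewrite /ball_union -bigcup_seq; split=> -[p ps px]; exists p. Qed.

Lemma in_closed_ball (x y : X) (r : R) : 0 < r ->
  closed_ball x r y <-> `|x - y| <= r.
Proof. by move=> r0; rewrite closed_ballE. Qed.

Lemma closed_ball_homothety (x t : X) (r c : R) : 0 < r -> 0 < c ->
  [set c *: y + t | y in closed_ball x r] = closed_ball (c *: x + t) (c * r).
Proof.
move=> r0 c0; apply/seteqP; split=> [_ [y /in_closed_ball yr <-]|y].
  apply/in_closed_ball; first exact: mulr_gt0.
  by rewrite opprD addrACA subrr addr0 -scalerBr normrZ gtr0_norm// ler_pM2l// yr.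
move=> /in_closed_ball yr; exists (c^-1 *: (y - t)).
  apply/in_closed_ball => //.
  rewrite -(ler_pM2l c0) -[X in X * _ <= _]gtr0_norm// -normrZ scalerBr scalerA.
  by rewrite mulfV ?gt_eqF// scale1r opprB addrA yr// mulr_gt0.
by rewrite scalerA mulfV ?gt_eqF// scale1r subrK.
Qed.

Lemma vlebesgue_closed_ball (x : X) (r : R) : 0 < r ->
  vlebesgue (closed_ball x r) = ((r ^+ n)%:E * vlebesgue unit_ball)%E.
Proof.
move=> r0; rewrite -(vlebesgue_homothety x) // closed_ball_homothety//.
by rewrite scaler0 add0r mulr1.
Qed.

(** In a normed space disjoint balls are so far apart that the distance of
    the centers exceeds the sum of the radii: otherwise a point of the
    segment joining the centers is common to both. *)
Lemma apart_disjoint p q : 0 < p.2 -> 0 < q.2 ->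
  apart p q <-> closed_ball p.1 p.2 `&` closed_ball q.1 q.2 = set0.
Proof.
case: p q => [x r] [y s]/= r0 s0; rewrite /apart/=; split=> [far|dis].
  rewrite -subset0 => z [/in_closed_ball/= zx /in_closed_ball/= zy].
  have := ler_distD z x y; rewrite (distrC z y).
  by have := zx r0; have := zy s0; lra.
rewrite ltNge; apply/negP => near.
have rs0 : 0 < r + s by rewrite addr_gt0.
have rs1 : r + s != 0 by rewrite gt_eqF.
suff : (closed_ball x r `&` closed_ball y s) (x + (r / (r + s)) *: (y - x)).
  by rewrite dis.
split; apply/in_closed_ball => //.
  rewrite opprD addNKr normrN normrZ ger0_norm; last by rewrite divr_ge0 ?ltW.
  by rewrite distrC mulrAC ler_pdivrMr// ler_pM2l.
have -> : y - (x + (r / (r + s)) *: (y - x)) = (s / (r + s)) *: (y - x).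
  have -> : s / (r + s) = 1 - r / (r + s) by field.
  by rewrite scalerBl scale1r opprD addrA.
rewrite normrZ ger0_norm; last by rewrite divr_ge0 ?ltW.
by rewrite distrC mulrAC ler_pdivrMr// ler_pM2l.
Qed.

Lemma apartC p q : apart p q = apart q p.
Proof. by rewrite /apart addrC distrC. Qed.

Lemma ball_union_cat s1 s2 : ball_union (s1 ++ s2) = ball_union s1 `|` ball_union s2.
Proof. by rewrite /ball_union big_cat. Qed.

Hypothesis n_gt0 : (0 < n)%N.
Hypothesis unit_fin : (vlebesgue unit_ball < +oo)%E.

Local Notation v1 := (vol unit_ball).

Lemma vol_ge0 (A : set X) : 0 <= vol A.
Proof. by rewrite fine_ge0// vlebesgue_ge0. Qed.

Lemma le_vol (A B : set X) : A `<=` B -> (vlebesgue B < +oo)%E -> vol A <= vol B.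
Proof.
move=> AB Bfin; have le := le_vlebesgue AB.
by apply: fine_le => //; rewrite ge0_fin_numE ?vlebesgue_ge0// (le_lt_trans le).
Qed.

Lemma vlebesgueU (A B : set X) : (vlebesgue (A `|` B) <= vlebesgue A + vlebesgue B)%E.
Proof. exact: (outer_measureU2 (outer_vlebesgue n_gt0)). Qed.

Lemma ball_union_fin s : positive_radii s -> (vlebesgue (ball_union s) < +oo)%E.
Proof.
elim: s => [|p s IH] /=; first by rewrite /ball_union big_nil vlebesgue0.
case/andP=> p0 /IH fin; rewrite /ball_union big_cons.
apply: le_lt_trans (vlebesgueU _ _) _; apply: lte_add_pinfty => //.
rewrite vlebesgue_closed_ball//; apply: lte_mul_pinfty => //.
by rewrite lee_fin exprn_ge0// ltW.
Qed.

Lemma vol_ball_union_cat s1 s2 : positive_radii s1 -> positive_radii s2 ->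
  vol (ball_union (s1 ++ s2)) <= vol (ball_union s1) + vol (ball_union s2).
Proof.
move=> /ball_union_fin f1 /ball_union_fin f2; rewrite ball_union_cat.
rewrite /vol -fineD ?ge0_fin_numE ?vlebesgue_ge0//.
apply: fine_le; rewrite ?vlebesgueU// ge0_fin_numE ?adde_ge0 ?vlebesgue_ge0//.
  by apply: le_lt_trans (vlebesgueU _ _) _; exact: lte_add_pinfty.
exact: lte_add_pinfty.
Qed.

Lemma vol_closed_ball (x : X) (r : R) : 0 < r -> vol (closed_ball x r) = r ^+ n * v1.
Proof.
by move=> r0; rewrite /vol vlebesgue_closed_ball// fineM// ge0_fin_numE ?vlebesgue_ge0.
Qed.

Lemma vol_ball_union_le s : positive_radii s ->
  vol (ball_union s) <= \sum_(p <- s) p.2 ^+ n * v1.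
Proof.
elim: s => [|p s IH] /=; first by rewrite /ball_union !big_nil /vol vlebesgue0.
case/andP=> p0 ps; rewrite big_cons.
have pp : positive_radii [:: p] by rewrite /= p0.
apply: le_trans (vol_ball_union_cat pp ps) _; apply: lerD; last exact: IH.
by rewrite /ball_union big_seq1 vol_closed_ball.
Qed.

(** Induction on the sequence: Caratheodory's criterion for the first ball splits
    it off from the union of the others. *)
Lemma vol_ball_union_apart s : positive_radii s -> pairwise apart s ->
  vol (ball_union s) = \sum_(p <- s) p.2 ^+ n * v1.
Proof.
elim: s => [|p s IH] /=; first by rewrite /ball_union !big_nil /vol vlebesgue0.
case/andP=> p0 ps /andP[pas /(IH ps) {}IH].
rewrite big_cons -IH -(vol_closed_ball p.1)//.
have sfin := ball_union_fin ps.
have pfin : (vlebesgue (closed_ball p.1 p.2) < +oo)%E.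
  have := @ball_union_fin [:: p]; rewrite /= p0 => /(_ isT).
  by rewrite /ball_union big_seq1.
rewrite /vol -fineD ?ge0_fin_numE ?vlebesgue_ge0//; congr fine.
have := closed_ball_caratheodory n_gt0 p.1 p0.
move=> /(_ (ball_union (p :: s))) /=; rewrite /outer_vlebesgue => ->.
have dis : closed_ball p.1 p.2 `&` ball_union s = set0.
  rewrite -subset0 => x [xp /ball_unionP[q qs xq]].
  have /apart_disjoint <- // : apart p q by exact: (allP pas).
  exact: (allP ps).
rewrite /ball_union big_cons.
apply: (congr2 (fun A B => vlebesgue A + vlebesgue B)%E).
  by rewrite setUK.
by rewrite -setDE setDUl setDv set0U; apply/setDidPl; rewrite setIC.
Qed.

End BallUnions.

(** * Two facts on sequences *)

Lemma seq_argmax (T : eqType) d (O : orderType d) (f : T -> O) x (s : seq T) :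
  exists2 y, y \in x :: s & {in x :: s, forall z, (f z <= f y)%O}.
Proof.
elim: s x => [|x' s IH] x.
  by exists x; rewrite ?mem_head// => z; rewrite inE => /eqP ->.
have [y ys ymax] := IH x'; have [xy|yx] := leP (f x) (f y).
  exists y; first by rewrite inE ys orbT.
  by move=> z; rewrite inE => /predU1P[->//|/ymax].
exists x; first exact: mem_head.
by move=> z; rewrite inE => /predU1P[->//|/ymax zy]; exact: le_trans zy (ltW yx).
Qed.

Lemma pairwise_sym_in (T : eqType) (r : rel T) (s : seq T) x y :
  symmetric r -> pairwise r s -> x \in s -> y \in s -> x != y -> r x y.
Proof.
move=> rC; elim: s => //= z s IH /andP[/allP zs ps].
rewrite !inE => /predU1P[->|xs] /predU1P[->|ys]; rewrite ?eqxx// => xy.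
- exact: zs.
- by rewrite rC zs.
- exact: IH.
Qed.

(** * Selection among balls of equal radius *)

Section Ratios.
Context {R : realType} {X : finNormedModType R}.
Local Notation n := (\dim {:X}).
Local Notation unit_ball := (closed_ball (0%R : X) 1%R).
Local Notation v1 := (vol unit_ball).
Implicit Types (C D : set (set X)) (S : set R).

Lemma trivIset_set0 C : [set D | D `<=` C /\ trivIset D id] set0.
Proof. by split => // B ? []. Qed.

Lemma Phi_ge0 C : 0 <= Phi C.
Proof.
rewrite /Phi; set E := [set _ | _ in _].
have [Esup|/sup_out ->//] := pselect (has_sup E).
apply: le_trans (ub_le_sup Esup.2 _); last first.
  by exists set0; [exact: trivIset_set0|reflexivity].
by rewrite divr_ge0 ?vol_ge0.
Qed.

Lemma Gamma_in_le_Phi S C : ball_collection S C -> Gamma_in X S <= Phi C.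
Proof.
by move=> CS; apply: ge_inf; [exists 0 => _ [? _ <-]; exact: Phi_ge0|exists C].
Qed.

Lemma singleton_ball_collection S (r : R) : 0 < r -> S r ->
  ball_collection S [set closed_ball (0 : X) r].
Proof.
move=> r0 Sr; split; first exact: finite_set1.
  by exists (closed_ball 0 r).
by move=> _ ->; exists 0, r.
Qed.

(** The inverse of zero and the real value of an infinite measure are both zero
    by convention; so if the unit ball is null or has infinite measure, then its
    own ratio vanishes and [gamma X = 0]. *)
Lemma gamma_gt0_unit_ball : 0 < gamma X ->
  0 < v1 /\ (vlebesgue unit_ball < +oo)%E.
Proof.
move=> g0; have v10 : 0 < v1.
  rewrite lt_def vol_ge0 andbT; apply/eqP => v10.
  have := lt_le_trans g0 (Gamma_in_le_Phi (singleton_ball_collection ltr01 erefl)).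
  rewrite ltNge => /negP; apply; apply: ge_sup.
    by eexists; exists set0; [exact: trivIset_set0|reflexivity].
  by move=> _ [D _ <-]; rewrite bigcup_set1 v10 invr0 mulr0.
split=> //; rewrite ltey; apply/eqP => voo.
by move: v10; rewrite /vol voo /= ltxx.
Qed.

Hypothesis n_gt0 : (0 < n)%N.

(** Rescaling to unit balls turns [gamma] into a selection principle for balls
    of any common radius. *)
Lemma equal_radius_selection (c t : R) (xs : seq X) :
  0 <= c -> c < gamma X -> 0 < t ->
  exists ys : seq X, [/\ {subset ys <= xs},
    pairwise (fun x y => t + t < `|x - y|) ys &
    c * vol (ball_union [seq (x, t) | x <- xs]) <= (size ys)%:R * (t ^+ n * v1)].
Proof.
move=> c0 cg t0; have [v10 v1fin] := gamma_gt0_unit_ball (le_lt_trans c0 cg).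
case: xs => [|x0 xs0].
  by exists [::]; split; rewrite // /ball_union big_nil /vol vlebesgue0// mulr0 mul0r.
set xs := x0 :: xs0.
pose b x : set X := closed_ball (t^-1 *: x) 1.
pose C := [set b x | x in [set` xs]].
have CB : ball_collection [set 1] C.
  split; [exact/finite_image/finite_seq|by exists (b x0), x0; rewrite //= mem_head|].
  by move=> _ [x _ <-]; exists (t^-1 *: x), 1.
have [|_ [D [DC Dtriv] <-] cD] := sup_gt _ (lt_le_trans cg (Gamma_in_le_Phi CB)).
  by eexists; exists set0; [exact: trivIset_set0|reflexivity].
have /choice[g gP] : forall B, exists x, D B -> x \in xs /\ B = b x.
  move=> B; have [/DC[x xxs <-]|nDB] := pselect (D B); first by exists x.
  by exists 0.
have [bs0 Dbs0] : exists s : seq (set X), D = [set` s].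
  by apply/finite_seqP; by case: CB => + _ _; exact: sub_finite_set.
pose bs := undup bs0.
have bsD B : B \in bs -> D B by rewrite mem_undup Dbs0.
exists [seq g B | B <- bs]; split.
- by move=> _ /mapP[B /bsD DB ->]; have [] := gP _ DB.
- rewrite pairwise_map; apply: (@sub_in_pairwise _ (mem bs) (fun B B' => B != B')).
  + move=> B B' /bsD DB /bsD DB' BB' /=.
    have [_ eB] := gP _ DB; have [_ eB'] := gP _ DB'.
    have : apart (t^-1 *: g B, 1) (t^-1 *: g B', 1).
      apply/apart_disjoint => //=; rewrite -/(b (g B)) -/(b (g B')) -eB -eB'.
      by move/trivIsetP : Dtriv; apply.
    rewrite /apart/= -scalerBr normrZ gtr0_norm ?invr_gt0// mulrC ltr_pdivlMr//.
    by rewrite mulrDl mul1r.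
  + exact/allP.
  + by rewrite -uniq_pairwise undup_uniq.
have pos1 (zs : seq X) : positive_radii [seq (t^-1 *: x, 1 : R) | x <- zs].
  by apply/allP => _ /mapP[x _ ->] /=.
have eC : \bigcup_(B in C) B = ball_union [seq (t^-1 *: x, 1) | x <- xs].
  rewrite /ball_union big_map -bigcup_seq; apply/seteqP; split=> y.
    by move=> [_ [x xxs <-] yx]; exists x.
  by move=> [x xxs yx]; exists (b x) => //; exists x.
have eD : \bigcup_(B in D) B = ball_union [seq (t^-1 *: x, 1) | x <- [seq g B | B <- bs]].
  rewrite /ball_union !big_map -bigcup_seq; apply/seteqP; split=> y.
    move=> [B DB yB]; exists B => /=; first by rewrite mem_undup; move: DB; rewrite Dbs0.
    by have [_ eB] := gP _ DB; rewrite -/(b _) -eB.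
  move=> [B /bsD DB /= yB]; exists B => //.
  by have [_ ->] := gP _ DB.
have -> : ball_union [seq (x, t) | x <- xs] =
    [set t *: y + 0 | y in \bigcup_(B in C) B].
  rewrite image_bigcup /ball_union big_map -bigcup_seq bigcup_image.
  apply: eq_bigcupr => x _; rewrite closed_ball_homothety//.
  by rewrite scalerA mulfV ?gt_eqF// scale1r addr0 mulr1.
have Cfin : (vlebesgue (\bigcup_(B in C) B) < +oo)%E by rewrite eC ball_union_fin.
rewrite {1}/vol vlebesgue_homothety// fineM// -?/(vol _); last first.
  by rewrite ge0_fin_numE ?vlebesgue_ge0.
have C0 : 0 < vol (\bigcup_(B in C) B).
  rewrite lt_def vol_ge0 andbT; apply/eqP => vC0.
  by move: cD; rewrite vC0 invr0 mulr0 ltNge c0.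
rewrite /= mulrCA [leRHS]mulrCA ler_pM2l ?exprn_gt0//.
move: cD; rewrite ltr_pdivlMr// => /ltW/le_trans; apply.
rewrite eD; apply: le_trans (vol_ball_union_le _ _ (pos1 _)) _ => //.
rewrite !big_map (eq_bigr (fun _ => v1)); last by move=> *; rewrite expr1n mul1r.
by rewrite big_const_seq count_predT iter_addr_0 size_map mulr_natl.
Qed.

End Ratios.

(** * Selection among balls of separated scales *)

Section Selection.
Context {R : realType} {X : finNormedModType R}.
Local Notation n := (\dim {:X}).
Local Notation unit_ball := (closed_ball (0%R : X) 1%R).
Local Notation v1 := (vol unit_ball).
Implicit Types (p q : X * R) (s D : seq (X * R)).

Hypothesis n_gt0 : (0 < n)%N.
Variable c : R.
Hypotheses (c0 : 0 <= c) (cg : c < gamma X).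

Let v1fin : (vlebesgue unit_ball < +oo)%E.
Proof. exact: (gamma_gt0_unit_ball (le_lt_trans c0 cg)).2. Qed.

(** If a ball meets another one whose radius is at least [2 * l] times larger,
    then it lies in the concentric enlargement of the latter by [1 + l^-1].
    Hence enlarging the balls of the top scale before the selection makes them
    cover also the smaller balls that it will discard, and the volume ratio of
    the enlargement is the only price for discarding them. *)
Lemma separated_scales_selection (rho l : R) (k : X * R -> int) s :
  0 < rho -> 0 < l -> positive_radii s ->
  {in s &, forall p q, k p = k q -> p.2 <= rho * q.2} ->
  {in s &, forall p q, k p < k q -> 2 * l * p.2 <= q.2} ->
  exists D, [/\ {subset D <= s}, pairwise apart D &
    c * vol (ball_union s) <=
    (rho * (1 + l^-1)) ^+ n * \sum_(p <- D) p.2 ^+ n * v1].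
Proof.
move=> rho0 l0; have [m] := ubnP (size s); elim: m s => // m IH [|p0 s0].
  move=> _ _ _ _; exists [::]; split=> //.
  by rewrite /ball_union !big_nil /vol vlebesgue0// !mulr0.
set s := p0 :: s0 => sm spos same diff.
have [p1 p1s p1max] := seq_argmax k p0 s0; rewrite -/s in p1s p1max.
pose T := [seq p <- s | k p == k p1].
have Ts p : p \in T -> p \in s /\ k p = k p1.
  by rewrite mem_filter => /andP[/eqP ? ?].
have p1T : p1 \in T by rewrite mem_filter eqxx.
have [p2 p2T p2max] : exists2 p2, p2 \in T & {in T, forall p, p.2 <= p2.2}.
  case: T p1T {Ts} => // q T' _; exact: (seq_argmax snd).
have [p2s p2k] := Ts _ p2T.
have rad p : p \in s -> 0 < p.2 by move/(allP spos).
(* With [p2.2] the largest radius of the top scale, radius [t] covers the balls of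
   that scale as well as the smaller balls that meet one of them. *)
pose a := 1 + l^-1; pose t := a * p2.2.
have a1 : 1 < a by rewrite ltrDl invr_gt0.
have a0 : 0 < a by exact: lt_trans a1.
have t0 : 0 < t by rewrite mulr_gt0// rad.
have [ys [ysT ysfar ysvol]] := equal_radius_selection n_gt0 [seq p.1 | p <- T] c0 cg t0.
have /choice[h hP] : forall y, exists p, y \in ys -> p \in T /\ p.1 = y.
  move=> y; have [/ysT/mapP[p pT ->]|nys] := boolP (y \in ys); first by exists p.
  by exists p0.
pose DT := [seq h y | y <- ys].
have DTT p : p \in DT -> p \in T by case/mapP=> y yys ->; case: (hP _ yys).
pose s' := [seq q <- s | (k q < k p1) && all (apart q) DT].
have s's q : q \in s' -> [/\ q \in s, k q < k p1 & all (apart q) DT].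
  by rewrite mem_filter => /andP[/andP[? ?] ?].
have s'pos : positive_radii s' by apply/allP => q /s's[/rad].
have s'm : (size s' < m)%N.
  apply: leq_trans (_ : size s <= m)%N => //; rewrite size_filter ltn_neqAle count_size andbT.
  rewrite -all_count; apply/allPn; exists p1 => //.
  by rewrite ltxx.
have [||D' [D's' D'far D'vol]] := IH s' s'm s'pos.
- by move=> p q /s's[ps _ _] /s's[qs _ _]; exact: same.
- by move=> p q /s's[ps _ _] /s's[qs _ _]; exact: diff.
exists (DT ++ D'); split.
- move=> p; rewrite mem_cat => /orP[/DTT/Ts[]//|/D's'/s's[]//].
- rewrite pairwise_cat D'far andbT; apply/andP; split.
    apply/allrelP => p q pD /D's'/s's[_ _ /allP/(_ p pD)].
    by rewrite apartC.
  rewrite pairwise_map; apply: (@sub_in_pairwise _ (mem ys)) ysfar; last exact/allP.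
  move=> x y /hP[hx ex] /hP[hy ey]; rewrite /apart/= ex ey; apply: le_lt_trans.
  have le1 p : p \in T -> p.2 <= t.
    by move=> pT; apply: le_trans (p2max _ pT) _; rewrite ler_peMl ?(ltW a1)// ltW// rad.
  by apply: lerD; exact: le1.
pose E := [seq (x, t) | x <- [seq p.1 | p <- T]].
have Epos : positive_radii E by apply/allP => _ /mapP[x _ ->].
have Es'pos : positive_radii (E ++ s').
  by rewrite /positive_radii all_cat; apply/andP; split.
have cov : ball_union s `<=` ball_union (E ++ s').
  have inE' p : p \in T -> (p.1, t) \in E.
    by move=> pT; apply/mapP; exists p.1 => //; apply/mapP; exists p.
  move=> x /ball_unionP[q qs /in_closed_ball xq]; have {}xq := xq (rad _ qs).
  apply/ball_unionP; have [kq|kq] := ltP (k q) (k p1); last first.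
    have qT : q \in T by rewrite mem_filter qs andbT eq_le kq p1max.
    exists (q.1, t); first by rewrite mem_cat inE'.
    apply/in_closed_ball => //=; apply: le_trans xq _.
    by apply: le_trans (p2max _ qT) _; rewrite ler_peMl ?(ltW a1)// ltW// rad.
  have [qfar|] := boolP (all (apart q) DT).
    exists q; first by rewrite mem_cat [X in _ || X]mem_filter kq qfar qs orbT.
    by apply/in_closed_ball => //; exact: rad.
  move=> /allPn[p /DTT pT]; rewrite /apart -leNgt => near.
  have [ps pk] := Ts _ pT.
  exists (p.1, t); first by rewrite mem_cat inE'.
  apply/in_closed_ball => //=.
  have ql : 2 * q.2 <= l^-1 * p.2.
    by rewrite ler_pdivlMl// mulrCA mulrA; apply: diff => //; rewrite pk.
  have : a * p.2 <= t by rewrite ler_pM2l// p2max.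
  have := ler_distD q.1 p.1 x; rewrite distrC in near.
  by rewrite /a mulrDl mul1r; lra.
rewrite big_cat/= mulrDr.
have step : c * vol (ball_union s) <= c * (vol (ball_union E) + vol (ball_union s')).
  rewrite ler_wpM2l//; apply: le_trans (le_vol cov (ball_union_fin n_gt0 v1fin Es'pos)) _.
  exact: vol_ball_union_cat.
apply: le_trans step _; rewrite mulrDr; apply: lerD => //.
apply: le_trans ysvol _.
rewrite big_map mulr_sumr -sum1_size natr_sum mulr_suml big_seq [leRHS]big_seq.
apply: ler_sum => y /hP[hy _]; rewrite mul1r mulrA ler_wpM2r ?vol_ge0// -exprMn.
have [hs hk] := Ts _ hy.
apply: lerXn2r; rewrite ?nnegrE ?(ltW t0)//.
  by rewrite !mulr_ge0 ?(ltW a0) ?(ltW rho0)// ltW// rad.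
by rewrite /t mulrAC [leRHS]mulrC ler_pM2l// same// p2k.
Qed.

Lemma vol_ball_union_flatten (I : Type) (F : I -> seq (X * R)) (js : seq I) :
  (forall j, positive_radii (F j)) ->
  vol (ball_union (flatten [seq F j | j <- js])) <=
  \sum_(j <- js) vol (ball_union (F j)).
Proof.
move=> Fpos; elim: js => [|j js IH] /=.
  by rewrite /ball_union !big_nil /vol vlebesgue0.
rewrite big_cons; apply: le_trans (vol_ball_union_cat _ _ _ _) _ => //; last first.
  by rewrite lerD2l.
elim: js {IH} => //= i js IH.
by rewrite /positive_radii all_cat; apply/andP; split; [exact: Fpos|exact: IH].
Qed.

Lemma largest_fiber_vol (m : nat) (f : X * R -> 'I_m.+1) s : positive_radii s ->
  exists j, vol (ball_union s) <=
    m.+1%:R * vol (ball_union [seq p <- s | f p == j]).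
Proof.
move=> spos; pose F j := [seq p <- s | f p == j].
have Fpos j : positive_radii (F j).
  by apply/allP => p; rewrite mem_filter => /andP[_ /(allP spos)].
have [j _ jmax] := @Order.TotalTheory.arg_maxP _ _ 'I_m.+1 ord0 xpredT
  (fun j => vol (ball_union (F j))) isT.
exists j.
apply: le_trans (le_vol (B := ball_union (flatten [seq F j | j <- enum 'I_m.+1])) _ _) _.
- move=> x /ball_unionP[p ps xp]; apply/ball_unionP; exists p => //.
  by apply/flatten_mapP; exists (f p); rewrite ?mem_enum// mem_filter eqxx.
- apply: ball_union_fin => //; apply/allP => p /flatten_mapP[i _].
  by move/(allP (Fpos i)).
apply: le_trans (vol_ball_union_flatten _ Fpos) _.
rewrite big_enum/= mulr_natl -[X in _ *+ X]card_ord -sumr_const.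
by apply: ler_sum => i _; exact: jmax.
Qed.

End Selection.

(** * Scales of radii *)

Section Scales.
Context {R : realType} (rho : R) (rho1 : 1 < rho).

Definition scale (r : R) : int := Num.floor (ln r / ln rho).

Lemma scaleP (r : R) : 0 < r ->
  (scale r)%:~R * ln rho <= ln r < ((scale r)%:~R + 1) * ln rho.
Proof.
move=> r0; have lr : 0 < ln rho by exact: ln_gt0.
rewrite -ler_pdivlMr// -ltr_pdivrMr// /scale floor_le/=.
by have := floorD1_gt (ln r / ln rho); rewrite intrD.
Qed.

Lemma same_scale (r s : R) : 0 < r -> 0 < s -> scale r = scale s -> r <= rho * s.
Proof.
move=> r0 s0 e; have rho0 : 0 < rho by exact: lt_trans rho1.
rewrite -ler_ln ?posrE ?mulr_gt0// lnM ?posrE//.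
by have := scaleP r0; have := scaleP s0; rewrite e mulrDl; lra.
Qed.

(** Congruent scales that differ do so by at least [m.+1], of which one unit is
    lost to rounding. *)
Lemma distinct_scales (m : nat) (r s : R) : 0 < r -> 0 < s ->
  (scale r = scale s %[mod m.+1])%Z -> scale r < scale s -> rho ^+ m * r <= s.
Proof.
move=> r0 s0 e lt; have rho0 : 0 < rho by exact: lt_trans rho1.
have lr : 0 < ln rho by exact: ln_gt0.
have gap : scale r + m.+1%:Z <= scale s.
  move/eqP : e; rewrite eq_sym eqz_mod_dvd => /dvdzP[z ez].
  by move: lt; rewrite -subr_gt0 -lerBrDl ez pmulr_lgt0// => z0; rewrite ler_peMl.
rewrite -ler_ln ?posrE ?mulr_gt0 ?exprn_gt0// lnM ?posrE ?exprn_gt0// lnXn//.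
have /andP[_ hr] := scaleP r0; have /andP[hs _] := scaleP s0.
have : (scale r)%:~R + m.+1%:R <= (scale s)%:~R :> R.
  by rewrite -(ler_int R) intrD in gap.
rewrite -(ler_pM2r lr) -natr1 !mulrDl -mulr_natl; move: hr; rewrite mulrDl; lra.
Qed.

End Scales.

(** * The lower bound with a free parameter *)

Section LowerBound.
Context {R : realType} {X : finNormedModType R}.
Local Notation n := (\dim {:X}).
Local Notation unit_ball := (closed_ball (0%R : X) 1%R).
Local Notation v1 := (vol unit_ball).

Lemma ball_collection_seq (C : set (set X)) : ball_collection [set r : R | 0 < r] C ->
  exists s : seq (X * R), [/\ positive_radii s, s != [::],
    forall p, p \in s -> C (closed_ball p.1 p.2) &
    \bigcup_(B in C) B = ball_union s].
Proof.
move=> [/finite_seqP[bs ->] [B0 B0s] Cball].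
have /choice[g gP] : forall B, exists p : X * R,
    B \in bs -> 0 < p.2 /\ B = closed_ball p.1 p.2.
  move=> B; have [/Cball[x [r [r0 _ ->]]]|nB] := boolP (B \in bs).
    by exists (x, r).
  by exists (0, 0).
exists [seq g B | B <- bs]; split.
- by apply/allP => _ /mapP[B /gP[? _] ->].
- by case: (bs) B0s.
- by move=> _ /mapP[B Bs ->]; have [_ <-] := gP _ Bs.
- rewrite /ball_union big_map -bigcup_seq; apply: eq_bigcupr => B Bs.
  by have [_ <-] := gP _ Bs.
Qed.

Lemma vol_ratio_le_Phi (C : set (set X)) (s D : seq (X * R)) :
  (0 < n)%N -> (vlebesgue unit_ball < +oo)%E -> positive_radii s ->
  (forall p, p \in s -> C (closed_ball p.1 p.2)) ->
  \bigcup_(B in C) B = ball_union s ->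
  {subset D <= s} -> pairwise apart D ->
  (\sum_(p <- D) p.2 ^+ n * v1) / vol (ball_union s) <= Phi C.
Proof.
move=> n_gt0 v1fin spos sC Cs Ds Dapart.
have Dpos : positive_radii D by apply/allP => p /Ds /(allP spos).
rewrite -(vol_ball_union_apart n_gt0 v1fin Dpos Dapart).
apply: ub_le_sup.
  exists 1 => _ [F [FC _] <-]; rewrite Cs.
  have [->|v0] := eqVneq (vol (ball_union s)) 0; first by rewrite invr0 mulr0.
  rewrite ler_pdivrMr ?mul1r ?lt_def ?v0 ?vol_ge0//.
  apply: le_vol; last exact: ball_union_fin.
  by rewrite -Cs; exact: bigcup_subset.
exists [set closed_ball p.1 p.2 | p in [set` D]].
  split; first by move=> _ [p /Ds /sC pC <-].
  apply/trivIsetP => _ _ [p pD <-] [q qD <-] pq.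
  apply/apart_disjoint; [exact: (allP Dpos)..|].
  apply: (pairwise_sym_in _ Dapart) => //; first exact: apartC.
  by apply: contraNneq pq => ->.
by rewrite Cs bigcup_image bigcup_seq.
Qed.

Lemma le_Gamma_in (S : set R) (a r : R) : 0 < r -> S r ->
  (forall C : set (set X), ball_collection S C -> a <= Phi C) -> a <= Gamma_in X S.
Proof.
move=> r0 Sr aPhi; apply: lb_le_inf; last by move=> _ [C CS <-]; exact: aPhi.
exists (Phi [set closed_ball (0 : X) r]), [set closed_ball (0 : X) r] => //.
exact: singleton_ball_collection.
Qed.

Lemma gamma_ge0 : 0 <= gamma X.
Proof. by apply: (le_Gamma_in ltr01) => // C _; exact: Phi_ge0. Qed.

Lemma Gamma_lower_bound (L : nat) : (0 < n)%N -> (0 < L)%N ->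
  (L%:R + 2)^-1 * ((2 * L%:R) `^ (L%:R + 1)^-1 * (1 + L%:R^-1)) ^- n * gamma X
    <= Gamma X.
Proof.
move=> n_gt0 L0; pose l : R := L%:R; pose rho := (2 * l) `^ (l + 1)^-1.
have l1 : 1 <= l by rewrite ler1n.
have l0 : 0 < l by exact: lt_le_trans l1.
have rhoL : rho ^+ L.+1 = 2 * l.
  rewrite -powR_mulrn ?powR_ge0// -powRrM -[L.+1%:R]natr1 mulVf ?powRr1//; first by lra.
  by rewrite gt_eqF// addr_gt0.
have rho1 : 1 < rho.
  have : 1 < rho ^+ L.+1 by rewrite rhoL; lra.
  by rewrite expr_gt1// ?powR_ge0.
have rho0 : 0 < rho by exact: lt_trans rho1.
have K0 : 0 < (rho * (1 + l^-1)) ^+ n.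
  by rewrite exprn_gt0// mulr_gt0// addr_gt0// invr_gt0.
have l20 : 0 < l + 2 by lra.
rewrite -/l -/rho -mulrA !ler_pdivrMl// leNgt; apply/negP => lt_gamma.
set a := (X in X < _) in lt_gamma.
have G0 : 0 <= Gamma X.
  by apply: (le_Gamma_in ltr01) => [|C _]; [exact: ltr01|exact: Phi_ge0].
have a0 : 0 <= a by rewrite !mulr_ge0// ltW.
(* A supremum that is at least [gamma X] need only be approached: the selection is
   made with a ratio [c] slightly below [gamma X]. *)
have [c ac cg] : exists2 c, a < c & c < gamma X.
  by exists ((a + gamma X) / 2); lra.
have c0 : 0 <= c by rewrite (le_trans a0)// ltW.
have [v10 v1fin] := gamma_gt0_unit_ball (le_lt_trans c0 cg).
suff : c <= a by rewrite leNgt ac.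
rewrite /a -!ler_pdivrMl//.
apply: (le_Gamma_in ltr01) => [|C Cball]; first exact: ltr01.
have [s [spos sn0 sC Cs]] := ball_collection_seq Cball.
pose residue (p : X * R) : 'I_L.+2 := inord `|(scale rho p.2 %% L.+2)%Z|.
have [j sj] := largest_fiber_vol n_gt0 c0 cg residue spos.
set sc := [seq p <- s | _] in sj.
have scs p : p \in sc -> p \in s /\ residue p = j.
  by rewrite mem_filter => /andP[/eqP ? ?].
have scpos : positive_radii sc by apply/allP => p /scs[/(allP spos)].
have cong p q : p \in sc -> q \in sc ->
    (scale rho p.2 = scale rho q.2 %[mod L.+2])%Z.
  move=> /scs[_ pj] /scs[_ qj]; have := pj; rewrite -qj => /(congr1 (@nat_of_ord _)).
  have lt (z : int) : (`|(z %% L.+2)%Z| < L.+2)%N.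
    by rewrite -ltz_nat gez0_abs ?modz_ge0// ltz_pmod.
  rewrite /residue !inordK// => e.
  by rewrite -[LHS]gez0_abs ?modz_ge0// e gez0_abs ?modz_ge0.
have [||D [Dsc Dapart Dvol]] :=
  separated_scales_selection n_gt0 c0 cg (k := fun p => scale rho p.2) rho0 l0 scpos.
- move=> p q /(allP scpos) p0 /(allP scpos) q0; exact: same_scale.
- move=> p q psc qsc lt; rewrite -rhoL; apply: distinct_scales => //.
  + exact: (allP scpos).
  + exact: (allP scpos).
  + exact: cong.
apply: le_trans (vol_ratio_le_Phi n_gt0 v1fin spos sC Cs _ Dapart); last first.
  by move=> p /Dsc/scs[].
have V0 : 0 < vol (ball_union s).
  case: s sn0 spos {sC Cs sj sc scs scpos cong Dsc Dvol} => // p s _ ps.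
  apply: lt_le_trans (_ : vol (closed_ball p.1 p.2) <= _).
    by rewrite vol_closed_ball//; case/andP: ps => ? _ //; rewrite mulr_gt0 ?exprn_gt0.
  apply: le_vol; last exact: ball_union_fin.
  by move=> x xp; apply/ball_unionP; exists p; rewrite ?mem_head.
rewrite ler_pdivlMr// -!mulrA !ler_pdivrMl//.
apply: (@le_trans _ _ ((l + 2) * (c * vol (ball_union sc)))).
  by rewrite [leRHS]mulrCA; apply: ler_wpM2l => //; rewrite /l -natrD addn2.
by rewrite [leRHS]mulrCA ler_wpM2l// ltW.
Qed.

End LowerBound.

(** * The choice of the parameter *)

Lemma ln2_bounds (R : realType) : 1 / 2 <= ln (2 : R) <= 1.
Proof.
apply/andP; split.
  rewrite -[leLHS]expRK ler_ln ?posrE ?expR_gt0//.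
  have := expR_ge1Dx (- (1 / 2) : R).
  by rewrite expRN -[(expR _)^-1]mul1r ler_pdivlMr ?expR_gt0//; lra.
by have -> : 2 = 1 + 1 :> R by []; apply: le_ln1Dx; lra.
Qed.

(** With [L] the integer part of [d ln d], the three factors contribute
    [ln (d ln d) + O(1 / ln d)], [1 + ln (ln d) / ln d + O(1 / ln d)] and
    [O(1 / ln d)] to the logarithm of the loss. *)
Lemma optimal_parameter (R : realType) (d : nat) : (2 <= d)%N ->
  exists2 L : nat, (0 < L)%N &
    expR (- 1 - ln (ln d%:R) / ln d%:R - 5 / ln d%:R) / (d%:R * ln d%:R) <=
    (L%:R + 2)^-1 * ((2 * L%:R) `^ (L%:R + 1)^-1 * (1 + L%:R^-1)) ^- d :> R.
Proof.
move=> d2; set lam : R := ln d%:R; set y := d%:R * lam.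
have /andP[ln2l ln2u] := ln2_bounds R.
have d2R : 2 <= d%:R :> R by rewrite ler_nat.
have lam2 : 1 / 2 <= lam.
  by apply: le_trans ln2l _; rewrite ler_ln ?posrE; lra.
have lam0 : 0 < lam by lra.
have y1 : 1 <= y by rewrite /y; nra.
have lamy : lam <= y by rewrite /y; nra.
have y0 : 0 < y by lra.
have := truncn_itv (ltW y0); set L := Num.truncn y; set l : R := L%:R.
rewrite -natr1 -/l => /andP[ly yl].
have L0 : (0 < L)%N by rewrite truncn_gt0.
have l1 : 1 <= l by rewrite ler1n.
exists L => //; rewrite -/l.
set a := (2 * l) `^ (l + 1)^-1; set b := 1 + l^-1.
have a0 : 0 < a by rewrite powR_gt0//; lra.
have li0 : 0 < l^-1 by rewrite invr_gt0; lra.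
have b0 : 0 < b by rewrite /b; lra.
have ab0 : 0 < (a * b) ^+ d by rewrite exprn_gt0// mulr_gt0.
have E1 : ln (l + 2) <= ln y + 2 / lam.
  apply: (@le_trans _ _ (ln (y * (1 + 2 / y)))).
    rewrite ler_ln ?posrE.
    - by rewrite mulrDr mulr1 mulrCA mulfV ?gt_eqF//; lra.
    - lra.
    - by rewrite mulr_gt0// addr_gt0// divr_gt0.
  rewrite lnM ?posrE//; last by rewrite addr_gt0// divr_gt0.
  rewrite lerD2l; apply: le_trans (le_ln1Dx _) _.
    by apply: lt_trans (_ : 0 < _); rewrite ?divr_gt0//; lra.
  by rewrite ler_pM2l// lef_pV2.
have E2 : d%:R * ln a <= (1 + lam + ln lam) / lam.
  rewrite /a ln_powR mulrA.
  have ln2l0 : 0 <= ln (2 * l) by apply: ln_ge0; lra.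
  apply: (@le_trans _ _ (lam^-1 * ln (2 * l))).
    apply: ler_wpM2r => //.
    rewrite ler_pdivrMr; last lra.
    rewrite ler_pdivlMl//; rewrite -/y in yl *.
    by rewrite mulrC ltW.
  rewrite mulrC; apply: ler_wpM2r; first by rewrite invr_ge0 ltW.
  apply: (@le_trans _ _ (ln (2 * y))); first by rewrite ler_ln ?posrE; lra.
  by rewrite !lnM ?posrE ?mulr_gt0 -?/lam; lra.
have E3 : d%:R * ln b <= 2 / lam.
  apply: (@le_trans _ _ (d%:R * l^-1)).
    by rewrite ler_wpM2l// le_ln1Dx//; lra.
  rewrite ler_pdivrMr; last lra.
  by rewrite mulrAC ler_pdivlMr//; rewrite -/y; lra.
have main : (l + 2) * (a * b) ^+ d <= y * expR (1 + ln lam / lam + 5 / lam).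
  rewrite -[leLHS]lnK ?posrE; last by rewrite mulr_gt0//; lra.
  rewrite -[X in _ <= X * _](lnK (x := y)) ?posrE// -expRD ler_expR.
  rewrite lnM ?posrE//; last lra.
  rewrite lnXn ?mulr_gt0// lnM ?posrE// -[_ *+ d]mulr_natl mulrDr.
  have -> : 1 + ln lam / lam + 5 / lam =
     2 / lam + (1 + lam + ln lam) / lam + 2 / lam.
    by field; rewrite gt_eqF.
  lra.
have -> : - 1 - ln lam / lam - 5 / lam = - (1 + ln lam / lam + 5 / lam) by lra.
rewrite expRN -!invfM lef_pV2 ?posrE ?mulr_gt0 ?expR_gt0//; last by lra.
  by rewrite [leRHS]mulrC.
by rewrite ltr0n ltnW.
Qed.


Theorem theorem2p2 (R : realType) :
  (forall (d : nat) (X : finNormedModType R) (L : nat),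
     (2 <= d)%N -> \dim {:X} = d -> (0 < L)%N ->
     Gamma X >=
       (L%:R + 2)^-1 *
       ((2 * L%:R) `^ (L%:R + 1)^-1 * (1 + L%:R^-1)) ^- d * gamma X)
  /\
  (exists K : R, 0 < K /\
     forall (d : nat) (X : finNormedModType R),
       (2 <= d)%N -> \dim {:X} = d ->
       Gamma X >=
         expR (- 1 - ln (ln d%:R) / ln d%:R - K / ln d%:R) *
         (gamma X / (d%:R * ln d%:R))).
Proof.
split=> [d X L d2 dX L0|].
  rewrite -dX in d2 *.
  exact: Gamma_lower_bound (ltnW d2) L0.
exists 5; split=> // d X d2 dX; have [L L0 loss] := optimal_parameter R d2.
have := @Gamma_lower_bound R X L; rewrite dX => /(_ (ltnW d2) L0).
apply: le_trans; rewrite mulrCA [leRHS]mulrC.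
by apply: ler_wpM2l => //; exact: gamma_ge0.
Qed.
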